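(* Let $q,n$ be positive integers, let $f:\mathbb{C}^q\to\mathbb{C}^n$ be a model function, let $\tilde y\in\mathbb{C}^n$, and put $r(\theta):=f(\theta)-\tilde y$. Fix $\theta\in\mathbb{C}^q$ at which the partial derivatives of $r$ exist, and let $J(\theta)\in\mathbb{C}^{n\times q}$ be the Jacobian matrix, whose $k$th column is $\partial r(\theta)/\partial\theta_k$. Let $\mathcal{W}$ be an $m$-dimensional subspace of $\mathbb{C}^n$ with $m\ge q$, and let $P_{\mathcal{W}}$ be the orthogonal projector onto $\mathcal{W}$. Assume that $J(\theta)$ and $P_{\mathcal{W}}J(\theta)$ have full column rank. Let $$s=-J(\theta)^+r(\theta),\qquad s_{\mathcal{W}}=-[P_{\mathcal{W}}J(\theta)]^+P_{\mathcal{W}}r(\theta)$$ be the Gauss-Newton steps at $\theta$ for the full problem (minimizing $\|f(\theta)-\tilde y\|_2^2$) and for the projected problem (minimizing $\|P_{\mathcal{W}}[f(\theta)-\tilde y]\|_2^2$), respectively. Then $$\|s-s_{\mathcal{W}}\|_2\le \|J(\theta)^+\|_2\,\|r(\theta)\|_2\left[\sin\phi_q(\mathcal{W},\mathcal{J}(\theta))+\tan^2\phi_q(\mathcal{W},\mathcal{J}(\theta))\right],$$ where $\mathcal{J}(\theta):=\operatorname{Range}J(\theta)$.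
   Context: $A^+$ denotes the Moore-Penrose pseudoinverse of $A$, and $\|\cdot\|_2$ denotes the Euclidean norm of vectors and the spectral norm of matrices. Canonical subspace angles: if $\mathcal{A},\mathcal{B}$ are subspaces of $\mathbb{C}^n$ with orthonormal bases given by the columns of $A\in\mathbb{C}^{n\times m_a}$ and $B\in\mathbb{C}^{n\times m_b}$, then for $k=1,\dots,\min\{m_a,m_b\}$ the angle $\phi_k(\mathcal{A},\mathcal{B})\in[0,\pi/2]$ is defined by $\cos\phi_k(\mathcal{A},\mathcal{B})=\sigma_k(A^*B)$, where $\sigma_k(X)$ is the $k$th singular value of $X$ in descending order. Thus $0\le\phi_1\le\phi_2\le\cdots\le\phi_{\min\{m_a,m_b\}}\le\pi/2$. *)

(* Defs.v *)
From HB Require Import structures.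
From mathcomp Require Import all_boot all_order all_algebra.
From mathcomp Require Export complex.
From mathcomp Require Import boolp classical_sets reals topology normedtype derive trigo.
Set Implicit Arguments.
Unset Strict Implicit.
Unset Printing Implicit Defensive.
Import Order.TTheory GRing.Theory Num.Theory numFieldNormedType.Exports.
Local Open Scope classical_set_scope.
Local Open Scope ring_scope.
Local Open Scope complex_scope.
Local Open Scope sesquilinear_scope.

Section Defs.
Variable R : realType.
Local Notation C := R[i].

Definition norm2 n (v : 'cV[C]_n) : R :=
  Num.sqrt (\sum_(i < n) Normc.normc (v i 0) ^+ 2).

(* All eigenvalues, repeated according to algebraic multiplicity. *)
Definition eigvals n (A : 'M[C]_n) : seq C :=
  sval (closed_field_poly_normal (char_poly A)).

(* The square roots of the eigenvalues of A^* A, in descending order. There are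
   n of them, so that for m < n the min(m, n) singular values of A are followed
   by zeros. *)
Definition singvals m n (A : 'M[C]_(m, n)) : seq R :=
  sort >=%O [seq Num.sqrt (complex.Re z) | z <- eigvals (A ^t* *m A)].

(* The index k starts at 1. *)
Definition sigma k m n (A : 'M[C]_(m, n)) : R := nth 0 (singvals A) k.-1.

(* The spectral norm: the largest singular value. *)
Definition mxnorm2 m n (A : 'M[C]_(m, n)) : R := sigma 1 A.

Definition penrose m n (A : 'M[C]_(m, n)) (X : 'M[C]_(n, m)) : Prop :=
  [/\ A *m X *m A = A, X *m A *m X = X,
      (A *m X) ^t* = A *m X & (X *m A) ^t* = X *m A].

Definition mpinv m n (A : 'M[C]_(m, n)) : 'M[C]_(n, m) := xget 0 (penrose A).

Definition mxrange n p (A : 'M[C]_(n, p)) : {vspace 'cV[C]_n} :=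
  limg (linfun (mulmx A : 'cV[C]_p -> 'cV[C]_n)).

Definition orthproj_on n (U : {vspace 'cV[C]_n}) (P : 'M[C]_n) : Prop :=
  [/\ P *m P = P, P ^t* = P & mxrange P = U].

Definition orthproj n (U : {vspace 'cV[C]_n}) : 'M[C]_n :=
  xget 0 (orthproj_on U).

Definition orthonormal_basis n p (U : {vspace 'cV[C]_n}) (A : 'M[C]_(n, p)) :=
  A ^t* *m A = 1%:M /\ mxrange A = U.

Definition onb n (U : {vspace 'cV[C]_n}) : 'M[C]_(n, \dim U) :=
  xget 0 (@orthonormal_basis n (\dim U) U).

(* The choice of the orthonormal bases is irrelevant: see angleE below. *)
Definition angle k n (U V : {vspace 'cV[C]_n}) : R :=
  acos (sigma k ((onb U) ^t* *m onb V)).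

Definition partial_derivable q n (r : 'cV[C]_q -> 'cV[C]_n) (t : 'cV[C]_q) :=
  forall k : 'I_q, derivable r t (delta_mx k 0).

Definition jacobian_mx q n (r : 'cV[C]_q -> 'cV[C]_n) (t : 'cV[C]_q) :
  'M[C]_(n, q) := \matrix_(i < n, k < q) ('D_(delta_mx k 0) r t : 'cV[C]_n) i 0.

Lemma adjM m n p (A : 'M[C]_(m, n)) (B : 'M[C]_(n, p)) :
  (A *m B) ^t* = B ^t* *m A ^t*.
Proof. by rewrite trmx_mul map_mxM. Qed.

Lemma adj1 n : (1%:M : 'M[C]_n) ^t* = 1%:M.
Proof. by rewrite trmx1 map_mx1. Qed.

Lemma memv_mxrange n p (A : 'M[C]_(n, p)) v :
  v \in mxrange A <-> exists x, v = A *m x.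
Proof.
split; first by move=> /memv_imgP [x _]; rewrite lfunE /=; exists x.
by case=> x ->; apply/memv_imgP; exists x; rewrite ?memvf// lfunE.
Qed.

Lemma mxrange_sub n p k (A : 'M[C]_(n, p)) (B : 'M[C]_(n, k)) :
  (mxrange B <= mxrange A)%VS -> exists X, B = A *m X.
Proof.
move=> /subvP sBA.
have /choice [f fE] (j : 'I_k) : exists x, col j B = A *m x.
  by apply/memv_mxrange/sBA/memv_mxrange; exists (delta_mx j 0); rewrite colE.
exists (\matrix_(i, j) f j i 0); apply/matrixP => i j.
have /matrixP /(_ i 0) := fE j; rewrite !mxE => ->.
by apply: eq_bigr => l _; rewrite !mxE.
Qed.

Lemma adjK m n (A : 'M[C]_(m, n)) : (A ^t*) ^t* = A.
Proof. by rewrite trmxCK. Qed.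

Lemma mulmx_adj_eq0 m n (A : 'M[C]_(m, n)) : A ^t* *m A = 0 -> A = 0.
Proof.
move=> A0; apply/matrixP => i j; rewrite [RHS]mxE.
have /matrixP /(_ j j) := A0; rewrite !mxE => /eqP.
rewrite psumr_eq0; last by move=> k _; rewrite !mxE mulrC mul_conjC_ge0.
move=> /allP /(_ i); rewrite mem_index_enum => /(_ isT) /=.
by rewrite !mxE mulrC mul_conjC_eq0 => /eqP.
Qed.

Lemma adj_rank m n (A : 'M[C]_(m, n)) : \rank (A ^t*) = \rank A.
Proof. by rewrite mxrank_map mxrank_tr. Qed.

Lemma adj_inv n (A : 'M[C]_n) : (invmx A) ^t* = invmx (A ^t*).
Proof. by rewrite trmx_inv map_invmx. Qed.

Lemma gram_unit m n (A : 'M[C]_(m, n)) : \rank A = n -> A ^t* *m A \in unitmx.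
Proof.
move=> rA; rewrite -row_free_unit -kermx_eq0.
set K := kermx _; have KA : K *m (A ^t* *m A) = 0 by rewrite mulmx_ker.
have /mulmx_adj_eq0 AK : (A *m K ^t*) ^t* *m (A *m K ^t*) = 0.
  by rewrite adjM adjK mulmxA -(mulmxA K) KA mul0mx.
have {}AK : K *m A ^t* = 0 by rewrite -[K]adjK -adjM AK trmx0 map_mx0.
by rewrite -(@mulmx_free_eq0 _ _ _ _ K (A ^t*)) ?AK// /row_free adj_rank rA.
Qed.

Lemma penroseP m n (A : 'M[C]_(m, n)) : penrose A (mpinv A).
Proof.
apply: (@xgetPex _ 0 (penrose A)).
have [p [L [S [AE uL uS]]]] : exists p (L : 'M[C]_(m, p)) (S : 'M[C]_(p, n)),
    [/\ A = L *m S, L ^t* *m L \in unitmx & S *m S ^t* \in unitmx].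
  exists (\rank A), (col_base A), (row_base A); split.
  - by rewrite mulmx_base.
  - by rewrite gram_unit//; apply/eqP; exact: col_base_full.
  - rewrite -{1}[row_base A]adjK gram_unit// adj_rank.
    by apply/eqP; exact: row_base_free.
set G := invmx (L ^t* *m L); set H := invmx (S *m S ^t*).
have G_adj : G ^t* = G by rewrite adj_inv adjM adjK.
have H_adj : H ^t* = H by rewrite adj_inv adjM adjK.
have GL := mulVmx uL; have SH := mulmxV uS; rewrite -/G -/H in GL SH.
have LtK := adjK L; have StK := adjK S.
move: G H G_adj H_adj GL SH {uL uS} => G H G_adj H_adj GL SH.
move LE : (L ^t*) LtK GL => Lt LtK GL; move SE : (S ^t*) StK SH => St StK SH.
have AX : A *m (St *m H *m G *m Lt) = L *m G *m Lt.
  by rewrite AE !mulmxA -(mulmxA L S) -(mulmxA L) SH mulmx1.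
have XA : St *m H *m G *m Lt *m A = St *m H *m S.
  by rewrite AE mulmxA -(mulmxA _ Lt) -(mulmxA _ G) GL mulmx1.
exists (St *m H *m G *m Lt); split.
- by rewrite AX AE mulmxA -(mulmxA _ Lt) -(mulmxA _ G) GL mulmx1.
- by rewrite XA !mulmxA -(mulmxA _ S) -(mulmxA _ (S *m St)) SH mulmx1.
- by rewrite AX !adjM LtK G_adj LE mulmxA.
- by rewrite XA !adjM StK H_adj SE mulmxA.
Qed.

Lemma penrose_uniq m n (A : 'M[C]_(m, n)) X Y :
  penrose A X -> penrose A Y -> X = Y.
Proof.
move=> [X1 X2 X3 X4] [Y1 Y2 Y3 Y4].
have AXY : A *m X = A *m Y.
  by rewrite -[LHS]X3 -{1}Y1 -(mulmxA (A *m Y)) adjM X3 Y3 mulmxA X1.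
have XAY : X *m A = Y *m A.
  by rewrite -[RHS]Y4 -{2}X1 !mulmxA -(mulmxA (Y *m A)) adjM Y4 X4 -mulmxA
    (mulmxA A) Y1.
by rewrite -X2 XAY -mulmxA AXY mulmxA Y2.
Qed.

Lemma onbP n (U : {vspace 'cV[C]_n}) : orthonormal_basis U (onb U).
Proof.
apply: (@xgetPex _ 0 (@orthonormal_basis n (\dim U) U)).
pose B : 'M[C]_(n, \dim U) := \matrix_(i, j) (vbasis U)`_j i 0.
have mulB (x : 'cV_(\dim U)) : B *m x = \sum_j x j 0 *: (vbasis U)`_j.
  apply/matrixP => i k; rewrite ord1 !mxE summxE.
  by apply: eq_bigr => j _; rewrite !mxE mulrC.
have rB : mxrange B = U.
  apply/vspaceP => v; apply/idP/idP.
    move/memv_mxrange => [x ->]; rewrite mulB memv_suml// => j _.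
    by rewrite memvZ// vbasis_mem// mem_nth// size_tuple.
  move=> /coord_vbasis vE; apply/memv_mxrange.
  exists (\col_j coord (vbasis U) j v); rewrite mulB {1}vE.
  by apply: eq_bigr => j _; rewrite mxE.
have freeB : row_free B^T.
  rewrite -kermx_eq0; apply/eqP/row_matrixP => i; rewrite row0.
  set x := row i _; have xB : B *m x^T = 0.
    by apply: trmx_inj; rewrite trmx_mul trmxK trmx0 -row_mul mulmx_ker row0.
  move: xB; rewrite mulB => xB.
  have /freeP /(_ _ xB) x0 := basis_free (vbasisP U).
  by apply/rowP => j; have := x0 j; rewrite mxE => ->; rewrite mxE.
have dn : (\dim U <= n)%N.
  by move: freeB; rewrite /row_free => /eqP <-; rewrite rank_leq_col.
have SU := schmidt_unitarymx B^T dn; set S := schmidt _ in SU.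
have SB : (S :=: B^T)%MS by exact: eqmx_schmidt_free.
exists S^T; split.
  have /unitarymxP SS := SU.
  by apply: trmx_inj; rewrite trmx_mul trmxK map_trmx trmx1.
apply: (etrans _ rB); apply/vspaceP => v; apply/idP/idP => /memv_mxrange [x ->];
  apply/memv_mxrange.
- have /submxP [D DE] : (S <= B^T)%MS by rewrite SB.
  by exists (D^T *m x); rewrite DE trmx_mul trmxK mulmxA.
- have /submxP [D DE] : (B^T <= S)%MS by rewrite SB.
  by exists (D^T *m x); rewrite mulmxA -trmx_mul -DE trmxK.
Qed.

Lemma orthonormal_basis_proj n p k (U : {vspace 'cV[C]_n}) (A : 'M[C]_(n, p))
    (X : 'M[C]_(n, k)) :
  orthonormal_basis U A -> (mxrange X <= U)%VS -> A *m (A ^t* *m X) = X.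
Proof.
move=> [AA <-] /mxrange_sub [Y ->].
by rewrite (mulmxA (A ^t*)) AA mul1mx.
Qed.

Lemma orthprojP n (U : {vspace 'cV[C]_n}) : orthproj_on U (orthproj U).
Proof.
apply: (@xgetPex _ 0 (@orthproj_on n U)).
have UA := onbP U; set A := onb U in UA; exists (A *m A ^t*); split.
- by rewrite mulmxA -(mulmxA A) UA.1 mulmx1.
- by rewrite adjM adjK.
- rewrite -[RHS]UA.2; apply/vspaceP => v.
  apply/idP/idP => /memv_mxrange [x ->]; apply/memv_mxrange.
  + by exists (A ^t* *m x); rewrite mulmxA.
  + by exists (A *m x); rewrite -mulmxA (mulmxA (A ^t*)) UA.1 mul1mx.
Qed.

Lemma orthproj_uniq n (U : {vspace 'cV[C]_n}) P Q :
  orthproj_on U P -> orthproj_on U Q -> P = Q.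
Proof.
move=> [PP Pa PU] [QQ Qa QU].
have [X PE] : exists X, P = Q *m X by apply: mxrange_sub; rewrite PU QU.
have [Y QE] : exists Y, Q = P *m Y by apply: mxrange_sub; rewrite PU QU.
have QP : Q *m P = P by rewrite {1}PE mulmxA QQ -PE.
have PQ : P *m Q = Q by rewrite {1}QE mulmxA PP -QE.
by rewrite -[P]Pa -QP adjM Pa Qa PQ.
Qed.

Lemma char_poly_similar n (A S T : 'M[C]_n) :
  T *m S = 1%:M -> char_poly (T *m A *m S) = char_poly A.
Proof.
move=> TS; have ST := mulmx1C TS; rewrite /char_poly.
have -> : char_poly_mx (T *m A *m S) =
    map_mx polyC T *m char_poly_mx A *m map_mx polyC S.
  rewrite /char_poly_mx !map_mxM mulmxBr mulmxBl; congr (_ - _).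
  by rewrite scalar_mxC -mulmxA -map_mxM TS map_mx1 mulmx1.
rewrite !det_mulmx mulrC mulrA -det_mulmx -map_mxM ST map_mx1 det1.
by rewrite mul1r.
Qed.

Lemma eq_sigma k m p n (A : 'M[C]_(m, n)) (B : 'M[C]_(p, n)) :
  char_poly (A ^t* *m A) = char_poly (B ^t* *m B) -> sigma k A = sigma k B.
Proof. by move=> AB; rewrite /sigma /singvals /eigvals AB. Qed.

Lemma angleE k n (U V : {vspace 'cV[C]_n})
    (A : 'M[C]_(n, \dim U)) (B : 'M[C]_(n, \dim V)) :
  orthonormal_basis U A -> orthonormal_basis V B ->
  angle k U V = acos (sigma k (A ^t* *m B)).
Proof.
move=> UA VB; have UA' := onbP U; have VB' := onbP V.
rewrite /angle; move: (onb U) (onb V) UA' VB' => A' B' UA' VB'.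
have sub p (D : 'M[C]_(n, p)) (W : {vspace 'cV[C]_n}) :
    orthonormal_basis W D -> (mxrange D <= W)%VS by case=> _ ->.
have A'E := orthonormal_basis_proj UA (sub _ _ _ UA').
have AE := orthonormal_basis_proj UA' (sub _ _ _ UA).
have B'E := orthonormal_basis_proj VB (sub _ _ _ VB').
set Q := A ^t* *m A' in A'E *; set S := B ^t* *m B' in B'E *.
have SS : S ^t* *m S = 1%:M.
  by rewrite {1}/S adjM adjK -mulmxA B'E VB'.1.
have QQ : Q *m Q ^t* = 1%:M.
  by rewrite {2}/Q adjM adjK /Q -mulmxA AE UA.1.
apply: congr1; apply: eq_sigma.
apply: etrans (char_poly_similar _ SS); apply: congr1.
clear AE; clearbody Q S; rewrite -A'E -B'E !adjM (adjK A) (adjK Q).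
move: (Q ^t*) (S ^t*) (A ^t*) (B ^t*) QQ => Qa Sa Aa Ba QQ.
by rewrite !mulmxA -(mulmxA _ Q) QQ mulmx1.
Qed.

End Defs.

(* Main.v *)
Require Import Defs.
From mathcomp Require Import all_boot all_order all_algebra complex.
From mathcomp Require Import boolp classical_sets reals topology normedtype derive trigo.
From mathcomp Require Import ring lra.
Set Implicit Arguments.
Unset Strict Implicit.
Unset Printing Implicit Defensive.
Import Order.TTheory GRing.Theory Num.Theory numFieldNormedType.Exports.
Local Open Scope ring_scope.
Local Open Scope complex_scope.
Local Open Scope sesquilinear_scope.

(** The two steps are compared through their images under J. Let x = J^+ r and
    z = (P J)^+ P r, so that s - s_W = z - x, and put w = J (z - x). Since J has
    full column rank, J^+ J = 1, hence z - x = J^+ w and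
    |s - s_W| <= |J^+| |w|. It remains to bound |w| by a multiple of |r|.

    Both x and z solve least squares problems, so their residuals satisfy normal
    equations: b = r - J x is orthogonal to range J, and P (J z - r) is
    orthogonal to P (range J). As J z - r = w - b and w lies in range J, this
    gives
      |P w|^2 = <P w, b> = - <w - P w, b> <= |w - P w| |b|,
    where the middle equality uses <w, b> = 0.

    Let c = cos phi_q. It is the least singular value of A^* B for orthonormal
    bases A of W and B of range J, so |P v| >= c |v| on range J, and by
    Pythagoras |v - P v| <= sqrt (1 - c^2) |v| there. With |b| <= |r| we get
    c^2 |w| <= sin phi_q |r|. Finally
      sin / cos^2 = sin (1 + tan^2) <= sin + tan^2.

    The lemmas carrying this are lsq_image_gap_bound (the inequality for w),
    cos_largest_angle (c as a lower bound of P on range J, and 0 < c <= 1), and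
    the extremal properties norm2_mulmx_le and norm2_mulmx_ge of the largest and
    least singular values, which come from the spectral theorem for A^* A. *)

(** * The real inner product of complex column vectors *)

Section RealInnerProduct.
Variable R : realType.
Local Notation C := R[i].

(** Real parts suffice, because every inner product in the argument ends up in a
    real inequality; they make the form symmetric and real bilinear. *)
Definition rdot n (u v : 'cV[C]_n) : R := complex.Re ((u ^t* *m v) 0 0).

Lemma ReD (x y : C) : complex.Re (x + y) = complex.Re x + complex.Re y.
Proof. by case: x; case: y. Qed.

Lemma Re_sum n (F : 'I_n -> C) :
  complex.Re (\sum_i F i) = \sum_i complex.Re (F i).
Proof. exact: (big_morph _ ReD). Qed.

Lemma adjD m n (A B : 'M[C]_(m, n)) : (A + B) ^t* = A ^t* + B ^t*.
Proof. by rewrite raddfD map_mxD. Qed.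

Lemma adjZ m n (a : R) (A : 'M[C]_(m, n)) : (a%:C *: A) ^t* = a%:C *: A ^t*.
Proof. by rewrite linearZ /= map_mxZ; congr (_ *: _); exact: conjc_real. Qed.

Lemma rdotDl n (u v w : 'cV[C]_n) : rdot (u + v) w = rdot u w + rdot v w.
Proof. by rewrite /rdot adjD mulmxDl mxE ReD. Qed.

Lemma rdotDr n (u v w : 'cV[C]_n) : rdot w (u + v) = rdot w u + rdot w v.
Proof. by rewrite /rdot mulmxDr mxE ReD. Qed.

Lemma rdotZr n (a : R) (u v : 'cV[C]_n) : rdot u (a%:C *: v) = a * rdot u v.
Proof.
rewrite /rdot -scalemxAr mxE; case: (_ 0 0) => x y /=.
by rewrite mul0r subr0.
Qed.

Lemma rdotC n (u v : 'cV[C]_n) : rdot u v = rdot v u.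
Proof.
rewrite /rdot -{1}[v]adjK -adjM !mxE.
by case: (\sum_i _).
Qed.

Lemma rdotZl n (a : R) (u v : 'cV[C]_n) : rdot (a%:C *: u) v = a * rdot u v.
Proof. by rewrite rdotC rdotZr rdotC. Qed.

Lemma rdotNr n (u v : 'cV[C]_n) : rdot u (- v) = - rdot u v.
Proof. by rewrite -scaleN1r -(rmorphN1 (real_complex R)) rdotZr mulN1r. Qed.

Lemma rdotNl n (u v : 'cV[C]_n) : rdot (- u) v = - rdot u v.
Proof. by rewrite rdotC rdotNr rdotC. Qed.

Lemma rdot0r n (u : 'cV[C]_n) : rdot u 0 = 0.
Proof. by rewrite /rdot mulmx0 mxE. Qed.

Lemma rdot_adj m n (A : 'M[C]_(m, n)) u v :
  rdot (A *m u) v = rdot u (A ^t* *m v).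
Proof. by rewrite /rdot adjM mulmxA. Qed.

Lemma norm2_ge0 n (v : 'cV[C]_n) : 0 <= norm2 v.
Proof. exact: sqrtr_ge0. Qed.

Lemma rdotE n (v : 'cV[C]_n) :
  rdot v v = \sum_i Normc.normc (v i 0) ^+ 2.
Proof.
rewrite /rdot mxE Re_sum; apply: eq_bigr => i _; rewrite !mxE.
case: (v i 0) => x y /=; rewrite sqr_sqrtr ?addr_ge0 ?sqr_ge0//.
ring.
Qed.

Lemma norm2_sqr n (v : 'cV[C]_n) : norm2 v ^+ 2 = rdot v v.
Proof. by rewrite rdotE sqr_sqrtr// sumr_ge0// => i _; rewrite sqr_ge0. Qed.

Lemma norm2_eq0 n (v : 'cV[C]_n) : norm2 v = 0 -> v = 0.
Proof.
move=> v0; have : norm2 v ^+ 2 = 0 by rewrite v0 expr0n.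
rewrite norm2_sqr rdotE => /eqP.
rewrite psumr_eq0 => [/allP z|i _]; last exact: sqr_ge0.
apply/colP => i; rewrite mxE; apply: Normc.eq0_normc; apply/eqP.
by rewrite -sqrf_eq0; apply: z; rewrite mem_index_enum.
Qed.

(** The Cauchy-Schwarz inequality: expand the square of the norm of
    |v| u - |u| v. *)
Lemma rdot_le n (u v : 'cV[C]_n) : rdot u v <= norm2 u * norm2 v.
Proof.
have [/norm2_eq0 ->|u0] := eqVneq (norm2 u) 0.
  by rewrite rdotC rdot0r mulr_ge0 ?norm2_ge0.
have [/norm2_eq0 ->|v0] := eqVneq (norm2 v) 0.
  by rewrite rdot0r mulr_ge0 ?norm2_ge0.
have ab0 : 0 < norm2 u * norm2 v by rewrite mulr_gt0// lt0r ?u0 ?v0 norm2_ge0.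
rewrite -(ler_pM2l ab0).
have := sqr_ge0 (norm2 ((norm2 v)%:C *: u - (norm2 u)%:C *: v)).
rewrite norm2_sqr rdotDl !rdotDr !(rdotNl, rdotNr) !(rdotZl, rdotZr).
rewrite (rdotC v u) -!norm2_sqr.
move: (norm2 u) (norm2 v) (rdot u v) => a b d; nra.
Qed.
End RealInnerProduct.

(** * Extremal properties of singular values *)

Section SingularValues.
Variable R : realType.
Local Notation C := R[i].

Lemma mem_eigvals n (A : 'M[C]_n) z :
  (z \in eigvals A) = eigenvalue A z.
Proof.
rewrite eigenvalue_root_char /eigvals.
case: closed_field_poly_normal => r /= rE.
by rewrite rE (monicP (char_poly_monic A)) scale1r root_prod_XsubC.
Qed.

Lemma size_eigvals n (A : 'M[C]_n) : size (eigvals A) = n.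
Proof.
rewrite /eigvals; case: closed_field_poly_normal => r /= rE.
have := size_char_poly A; rewrite rE (monicP (char_poly_monic A)) scale1r.
by rewrite size_prod_XsubC => -[].
Qed.

Lemma gram_adj m n (A : 'M[C]_(m, n)) : (A ^t* *m A) ^t* = A ^t* *m A.
Proof. by rewrite adjM adjK. Qed.

Lemma norm2_mulmx_sqr m n (A : 'M[C]_(m, n)) v :
  norm2 (A *m v) ^+ 2 = rdot v (A ^t* *m A *m v).
Proof. by rewrite norm2_sqr rdot_adj mulmxA. Qed.

(** The singular values are square roots of real parts of eigenvalues of A^* A;
    this identity is what ties them to norms. Only the real part matters since
    v^* A^* A v and v^* v are real. *)
Lemma gram_eigvalsP m n (A : 'M[C]_(m, n)) z : z \in eigvals (A ^t* *m A) ->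
  exists2 v, v != 0 & norm2 (A *m v) ^+ 2 = complex.Re z * norm2 v ^+ 2.
Proof.
rewrite mem_eigvals => /eigenvalueP [v vz v0].
(* Eigenvectors are row vectors here, acting on the left. *)
exists (v ^t*).
  by apply: contraNneq v0 => v0; rewrite -[v]adjK v0 trmx0 map_mx0.
rewrite norm2_mulmx_sqr norm2_sqr /rdot adjK mulmxA vz -scalemxAl mxE.
have : 0 <= (v *m v ^t*) 0 0.
  by rewrite mxE sumr_ge0// => i _; rewrite !mxE mul_conjC_ge0.
case: ((v *m _) 0 0) => x y; rewrite lecE /= => /andP [/eqP -> _].
by case: z {vz} => a b /=; rewrite mulr0 subr0.
Qed.

Lemma gram_eigvals_ge0 m n (A : 'M[C]_(m, n)) z :
  z \in eigvals (A ^t* *m A) -> 0 <= complex.Re z.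
Proof.
move=> /gram_eigvalsP [v v0 vE].
have v2 : 0 < norm2 v ^+ 2.
  rewrite exprn_gt0// lt0r norm2_ge0 andbT.
  by apply: contraNneq v0 => /norm2_eq0 ->.
by rewrite -(pmulr_lge0 _ v2) -vE sqr_ge0.
Qed.

Lemma size_singvals m n (A : 'M[C]_(m, n)) : size (singvals A) = n.
Proof. by rewrite size_sort size_map size_eigvals. Qed.

Lemma singvalsP m n (A : 'M[C]_(m, n)) x : x \in singvals A ->
  0 <= x /\ exists2 v, v != 0 & norm2 (A *m v) = x * norm2 v.
Proof.
rewrite mem_sort => /mapP [z zA ->]; split; first exact: sqrtr_ge0.
have [v v0 vE] := gram_eigvalsP zA; exists v => //.
apply/(@pexpIrn _ 2) => //; rewrite ?nnegrE ?mulr_ge0 ?sqrtr_ge0//.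
by rewrite vE exprMn [in RHS]sqr_sqrtr ?(gram_eigvals_ge0 zA).
Qed.

Lemma singvals_sorted m n (A : 'M[C]_(m, n)) : sorted >=%O (singvals A).
Proof. by apply: sort_sorted => x y; rewrite le_total. Qed.

(** Unitary diagonalization of the Hermitian matrix A^* A = U^* D U, recorded as
    what it says about norms: in the coordinates U v, the squared norm of A v is
    a sum weighted by squares of singular values. The extremal properties of the
    largest and the least singular value follow term by term. *)
Lemma norm2_spectral m n (A : 'M[C]_(m, n)) :
  exists (U : 'M[C]_n) (d : 'I_n -> R),
  [/\ forall i, d i \in singvals A,
      forall v, norm2 v ^+ 2 = \sum_i Normc.normc ((U *m v) i 0) ^+ 2
    & forall v, norm2 (A *m v) ^+ 2 =
        \sum_i d i ^+ 2 * Normc.normc ((U *m v) i 0) ^+ 2].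
Proof.
set H := A ^t* *m A.
have Hh : H \is hermsymmx.
  by apply/is_hermitianmxP; rewrite expr0 scale1r gram_adj.
have /orthomx_spectralP := hermitian_normalmx Hh.
have := spectral_unitarymx H.
set U := spectralmx H; set D := spectral_diag H => UU HE.
have Ui : invmx U = U ^t* by rewrite invmx_unitary.
have U1 : U ^t* *m U = 1%:M by rewrite -Ui mulVmx ?unitarymx_unit.
have UU1 : U *m U ^t* = 1%:M by exact: mulmx1C.
(* The i-th row of U is a left eigenvector of H for D i. *)
have ev i : D 0 i \in eigvals H.
  rewrite mem_eigvals; apply/eigenvalueP; exists (delta_mx 0 i *m U).
    rewrite HE Ui !mulmxA -(mulmxA _ U) UU1 mulmx1 scalemxAl; congr (_ *m _).
    by rewrite -rowE row_diag_mx.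
  apply/eqP => /(congr1 (mulmx^~ (U ^t*))).
  rewrite -mulmxA UU1 mulmx1 mul0mx => /matrixP /(_ 0 i).
  by rewrite !mxE !eqxx => /eqP; rewrite oner_eq0.
have D0 i : 0 <= complex.Re (D 0 i) by exact: gram_eigvals_ge0 (ev i).
have DR i : D 0 i = (complex.Re (D 0 i))%:C.
  by rewrite RRe_real//; apply/mxOverP/hermitian_spectral_diag_real.
exists U, (fun i => Num.sqrt (complex.Re (D 0 i))); split.
- by move=> i; rewrite mem_sort; apply: map_f.
- by move=> v; rewrite -rdotE rdot_adj mulmxA U1 mul1mx norm2_sqr.
- move=> v; rewrite norm2_mulmx_sqr -/H HE Ui -!mulmxA -rdot_adj.
  rewrite /rdot mxE Re_sum; apply: eq_bigr => i _.
  rewrite sqr_sqrtr// mul_diag_mx !mxE [X in _ * (X * _)]DR.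
  case: (\sum_j _) => x y /=; rewrite sqr_sqrtr ?addr_ge0 ?sqr_ge0//.
  ring.
Qed.

Lemma norm2_mulmx_le m n (A : 'M[C]_(m, n)) v :
  norm2 (A *m v) <= mxnorm2 A * norm2 v.
Proof.
have [U [d [dA vE AvE]]] := norm2_spectral A.
have [n0|n0] := posnP n.
  (* Without columns the list of singular values is empty and mxnorm2 A is the
     default value 0. *)
  subst n; rewrite (_ : v = 0) ?mulmx0; last by apply/colP; case.
  suff z k : norm2 (0 : 'cV[C]_k) = 0 by rewrite !z mulr0.
  by apply/eqP; rewrite -sqrf_eq0 norm2_sqr rdot0r.
have max_d i : 0 <= d i <= mxnorm2 A.
  have [-> _] := singvalsP (dA i); rewrite /mxnorm2 /sigma /=.
  have iA := dA i; rewrite -(nth_index 0 iA).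
  apply: (sorted_leq_nth (rev_trans le_trans) lexx 0 (singvals_sorted A)) => //.
    by rewrite inE size_singvals.
  by rewrite inE index_mem.
have m0 : 0 <= mxnorm2 A by have /andP [] := max_d (Ordinal n0); exact: le_trans.
rewrite -ler_sqr ?nnegrE ?mulr_ge0 ?norm2_ge0// exprMn AvE vE mulr_sumr.
apply: ler_sum => i _; rewrite ler_wpM2r ?sqr_ge0//.
by have /andP [? ?] := max_d i; rewrite ler_sqr ?nnegrE.
Qed.

(** Since A has n columns, sigma n A is the last entry of its list of singular
    values, hence the least one. *)
Lemma norm2_mulmx_ge m n (A : 'M[C]_(m, n)) v : (0 < n)%N ->
  sigma n A * norm2 v <= norm2 (A *m v).
Proof.
move=> n0; have [U [d [dA vE AvE]]] := norm2_spectral A.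
have n1 : (n.-1 < size (singvals A))%N by rewrite size_singvals prednK.
have [s0 _] := singvalsP (mem_nth 0 n1).
have min_d i : sigma n A <= d i.
  have iA := dA i; rewrite -(nth_index 0 iA).
  have iN : (index (d i) (singvals A) < size (singvals A))%N by rewrite index_mem.
  apply: (sorted_leq_nth (rev_trans le_trans) lexx 0 (singvals_sorted A)) => //.
  by rewrite -ltnS prednK// -[X in (_ < X)%N](size_singvals A).
rewrite -ler_sqr ?nnegrE ?mulr_ge0 ?norm2_ge0// exprMn AvE vE mulr_sumr.
apply: ler_sum => i _; rewrite ler_wpM2r ?sqr_ge0//.
by rewrite ler_sqr ?nnegrE ?(le_trans s0 (min_d i)).
Qed.

Lemma sigma_attained k m n (A : 'M[C]_(m, n)) : (0 < k <= n)%N ->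
  0 <= sigma k A /\ exists2 v, v != 0 & norm2 (A *m v) = sigma k A * norm2 v.
Proof.
case: k => // k /andP [_ kn].
by apply: singvalsP; rewrite mem_nth// size_singvals.
Qed.
End SingularValues.

(** * Pseudoinverses, projectors and angles *)

Section Geometry.
Variable R : realType.
Local Notation C := R[i].

Lemma mpinv_left_inv m n (A : 'M[C]_(m, n)) :
  \rank A = n -> mpinv A *m A = 1%:M.
Proof.
move=> rA; have [AXA _ _ _] := penroseP A.
have fA : row_free A^T by rewrite /row_free mxrank_tr rA.
apply: trmx_inj; apply: (row_free_inj fA); rewrite /mulmxr /=.
by rewrite -!trmx_mul mulmxA AXA mulmx1.
Qed.

(** The normal equations: A^+ v is a least squares solution. They hold because
    A A^+ is Hermitian. *)
Lemma mpinv_normal m n (A : 'M[C]_(m, n)) (v : 'cV[C]_m) :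
  A ^t* *m (A *m (mpinv A *m v)) = A ^t* *m v.
Proof.
have [AXA _ AX _] := penroseP A.
by rewrite (mulmxA A) (mulmxA (A ^t*)) -AX -adjM AXA.
Qed.

Lemma dim_mxrange m n (A : 'M[C]_(m, n)) : \rank A = n -> \dim (mxrange A) = n.
Proof.
move=> rA; rewrite /mxrange limg_dim_eq ?dimvf ?dim_matrix; first exact: muln1.
apply/eqP; rewrite -subv0; apply/subvP => x.
rewrite memv_cap memv_ker lfunE /= memv0 => /andP [_ /eqP Ax].
by rewrite -[x]mul1mx -(mpinv_left_inv rA) -mulmxA Ax mulmx0.
Qed.

Lemma orthprojE n p (U : {vspace 'cV[C]_n}) (A : 'M[C]_(n, p)) :
  orthonormal_basis U A -> orthproj U = A *m A ^t*.
Proof.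
move=> UA; apply: orthproj_uniq (orthprojP U) _; split.
- by rewrite mulmxA -(mulmxA A) UA.1 mulmx1.
- by rewrite adjM adjK.
- rewrite -UA.2; apply/vspaceP => v.
  apply/idP/idP => /memv_mxrange [x ->]; apply/memv_mxrange.
  + by exists (A ^t* *m x); rewrite mulmxA.
  + by exists (A *m x); rewrite -mulmxA (mulmxA (A ^t*)) UA.1 mul1mx.
Qed.

Lemma norm2_isometry n p (A : 'M[C]_(n, p)) v :
  A ^t* *m A = 1%:M -> norm2 (A *m v) = norm2 v.
Proof.
move=> AA; apply/(@pexpIrn _ 2) => //; rewrite ?nnegrE ?norm2_ge0//.
by rewrite norm2_mulmx_sqr AA mul1mx norm2_sqr.
Qed.

Lemma pythagoras_proj n (P : 'M[C]_n) v : P *m P = P -> P ^t* = P ->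
  norm2 v ^+ 2 = norm2 (P *m v) ^+ 2 + norm2 (v - P *m v) ^+ 2.
Proof.
move=> PP Pa; have vP : rdot (P *m v) v = rdot (P *m v) (P *m v).
  by rewrite [RHS]rdot_adj Pa mulmxA PP rdot_adj Pa.
rewrite !norm2_sqr rdotDl !rdotDr !rdotNl !rdotNr (rdotC v (P *m v)) vP.
ring.
Qed.

Lemma norm2_sub_proj_le n (P : 'M[C]_n) v : P *m P = P -> P ^t* = P ->
  norm2 (v - P *m v) <= norm2 v.
Proof.
move=> PP Pa; rewrite -ler_sqr ?nnegrE ?norm2_ge0//.
by rewrite (pythagoras_proj v PP Pa) lerDr sqr_ge0.
Qed.

Lemma norm2_proj_le n (P : 'M[C]_n) v : P *m P = P -> P ^t* = P ->
  norm2 (P *m v) <= norm2 v.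
Proof.
move=> PP Pa; rewrite -ler_sqr ?nnegrE ?norm2_ge0//.
by rewrite (pythagoras_proj v PP Pa) lerDl sqr_ge0.
Qed.

(** The smallest cosine c is the least singular value of A^* B, where A and B
    are orthonormal bases of W and of the range of J, and |A^* v| = |P v|; so c
    bounds P below on the range of J. The value c is attained at some B v with
    v nonzero: c <= 1 since P is a contraction, and c = 0 would put a nonzero
    vector of the range of J in the kernel of P, against the rank of P J. *)
Lemma cos_largest_angle n q (J : 'M[C]_(n, q)) (W : {vspace 'cV[C]_n}) :
  (0 < q)%N -> \rank J = q -> \rank (orthproj W *m J) = q ->
  exists c : R, [/\ angle q W (mxrange J) = acos c, 0 < c <= 1
    & forall x, c * norm2 (J *m x) <= norm2 (orthproj W *m (J *m x))].
Proof.
set P := orthproj W => q0 rJ rPJ.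
have WA := onbP W; have VB := onbP (mxrange J).
set A := onb W in WA *; set B := onb (mxrange J) in VB *.
have PE : P = A *m A ^t* by exact: orthprojE.
have nP v : norm2 (P *m v) = norm2 (A ^t* *m v).
  by rewrite PE -mulmxA norm2_isometry// WA.1.
have dJ := dim_mxrange rJ.
exists (sigma q (A ^t* *m B)); split; first exact: angleE.
- have [c0 [v v0 vE]] : 0 <= sigma q (A ^t* *m B) /\ exists2 v, v != 0 &
      norm2 (A ^t* *m B *m v) = sigma q (A ^t* *m B) * norm2 v.
    by apply: sigma_attained; rewrite q0 dJ leqnn.
  have v2 : 0 < norm2 v.
    by rewrite lt0r norm2_ge0 andbT; apply: contraNneq v0 => /norm2_eq0 ->.
  have [PP Pa _] := orthprojP W; rewrite -/P in PP Pa.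
  rewrite -mulmxA -nP in vE; rewrite lt0r c0 andbT; apply/andP; split.
    apply: contraNneq v0 => c00; rewrite c00 mul0r in vE.
    have [x xE] : exists x, B *m v = J *m x.
      suff : B *m v \in mxrange B by rewrite VB.2 => /memv_mxrange.
      by apply/memv_mxrange; exists v.
    move/norm2_eq0: vE; rewrite xE mulmxA => Jx.
    have x0 : x = 0.
      by rewrite -[x]mul1mx -(mpinv_left_inv rPJ) -mulmxA Jx mulmx0.
    by rewrite -[v]mul1mx -VB.1 -mulmxA xE x0 !mulmx0.
  by rewrite -(ler_pM2r v2) -vE mul1r -(norm2_isometry v VB.1) norm2_proj_le.
- move=> x; have [y ->] : exists y, J *m x = B *m y.
    by apply/memv_mxrange; rewrite VB.2; apply/memv_mxrange; exists x.
  rewrite nP mulmxA norm2_isometry ?VB.1//.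
  (* B has \dim (mxrange J) columns; renaming that number q makes sigma q the
     least singular value. *)
  move: B y {VB}; rewrite dJ => B y; exact: norm2_mulmx_ge.
Qed.

(** The vectors x and y solve the normal equations of the full and of the
    projected problem. With w = J (y - x) and b = r - J x, they give
    <w, b> = 0 and <w, P (w - b)> = 0, hence |P w|^2 = - <w - P w, b>. The left
    side is at least c^2 |w|^2, the right side at most
    sqrt (1 - c^2) |w| |b|, and one factor |w| cancels. *)
Lemma lsq_image_gap_bound n q (J : 'M[C]_(n, q)) (P : 'M[C]_n)
    (r : 'cV[C]_n) (x y : 'cV[C]_q) (c : R) :
  P *m P = P -> P ^t* = P ->
  J ^t* *m (J *m x) = J ^t* *m r ->
  (P *m J) ^t* *m (P *m J *m y) = (P *m J) ^t* *m (P *m r) ->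
  0 < c <= 1 ->
  (forall z, c * norm2 (J *m z) <= norm2 (P *m (J *m z))) ->
  c ^+ 2 * norm2 (J *m (y - x)) <= Num.sqrt (1 - c ^+ 2) * norm2 (r - J *m x).
Proof.
move=> PP Pa Jx PJy /andP [c0 c1] cP.
set w := J *m (y - x); set b := r - J *m x.
have s0 : 0 <= 1 - c ^+ 2 by rewrite subr_ge0 exprn_ile1// ltW.
have wb z : rdot (J *m z) b = 0.
  by rewrite rdot_adj mulmxBr Jx subrr rdot0r.
have wP : rdot w (P *m (w - b)) = 0.
  have -> : w - b = J *m y - r by rewrite /w /b mulmxBr opprB addrA subrK.
  have : rdot (P *m J *m (y - x)) (P *m J *m y - P *m r) = 0.
    by rewrite rdot_adj mulmxBr PJy subrr rdot0r.
  by rewrite -!mulmxA -mulmxBr rdot_adj Pa mulmxA PP.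
have Pw : norm2 (P *m w) ^+ 2 = - rdot (w - P *m w) b.
  rewrite rdotDl rdotNl wb add0r opprK norm2_mulmx_sqr Pa PP.
  rewrite rdot_adj Pa; apply/eqP; rewrite -subr_eq0 -rdotNr -rdotDr.
  by rewrite -mulmxBr wP.
have sw : norm2 (w - P *m w) <= Num.sqrt (1 - c ^+ 2) * norm2 w.
  rewrite -ler_sqr ?nnegrE ?mulr_ge0 ?norm2_ge0 ?sqrtr_ge0//.
  rewrite exprMn (sqr_sqrtr s0) mulrBl mul1r lerBrDr -exprMn.
  rewrite [leRHS](pythagoras_proj w PP Pa) addrC lerD2r.
  by rewrite ler_sqr ?nnegrE ?mulr_ge0 ?norm2_ge0 ?(ltW c0)//; exact: cP.
have [->|w0] := eqVneq (norm2 w) 0.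
  by rewrite mulr0 mulr_ge0 ?sqrtr_ge0 ?norm2_ge0.
have {}w0 : 0 < norm2 w by rewrite lt0r w0 norm2_ge0.
rewrite -(ler_pM2r w0) -mulrA -expr2 -exprMn.
apply: (@le_trans _ _ (norm2 (P *m w) ^+ 2)).
  by rewrite ler_sqr ?nnegrE ?mulr_ge0 ?norm2_ge0 ?(ltW c0)//; exact: cP.
rewrite Pw -rdotNl; apply: (le_trans (rdot_le _ _)).
have -> : norm2 (- (w - P *m w)) = norm2 (w - P *m w).
  apply/(@pexpIrn _ 2); rewrite ?nnegrE ?norm2_ge0//.
  by rewrite !norm2_sqr rdotNl rdotNr opprK.
by rewrite mulrAC ler_wpM2r ?norm2_ge0.
Qed.

(** Because 1 / c^2 = 1 + (s / c)^2, the left side is s + s (s / c)^2, and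
    s <= 1. *)
Lemma sin_div_cos2_le (s c : R) : 0 <= s -> 0 < c -> c ^+ 2 + s ^+ 2 = 1 ->
  s / c ^+ 2 <= s + (s / c) ^+ 2.
Proof.
move=> s0 c0 cs; have c2 : 0 < c ^+ 2 by rewrite exprn_gt0.
rewrite expr_div_n ler_pdivrMr// mulrDl divfK ?gt_eqF//.
have s1 : s <= 1 by nra.
nra.
Qed.
End Geometry.

Theorem theorem2p1 (R : realType) (q n m : nat)
  (q_gt0 : (0 < q)%N) (n_gt0 : (0 < n)%N)
  (f : 'cV[R[i]]_q -> 'cV[R[i]]_n) (y : 'cV[R[i]]_n) (theta : 'cV[R[i]]_q)
  (W : {vspace 'cV[R[i]]_n}) (dimW : \dim W = m) (q_le_m : (q <= m)%N) :
  let r := fun t : 'cV[R[i]]_q => f t - y in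
  let J := jacobian_mx r theta in
  let P := orthproj W in
  partial_derivable r theta ->
  \rank J = q ->
  \rank (P *m J) = q ->
  let s := - (mpinv J *m r theta) in
  let sW := - (mpinv (P *m J) *m (P *m r theta)) in
  let phi := angle q W (mxrange J) in
  norm2 (s - sW) <=
    mxnorm2 (mpinv J) * norm2 (r theta) * (sin phi + tan phi ^+ 2).
Proof.
move=> r J P _ rJ rPJ; cbv zeta.
have [c [phiE c01 cP]] := cos_largest_angle q_gt0 rJ rPJ.
have [PP Pa _] := orthprojP W; rewrite -/P in PP Pa cP.
have /andP [c0 c1] := c01.
have cin : -1 <= c <= 1 by rewrite c1 andbT; lra.
rewrite /tan phiE sin_acos// acosK ?in_itv//.
set x := mpinv J *m r theta; set z := mpinv (P *m J) *m (P *m r theta).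
rewrite opprK addrC.
have key := lsq_image_gap_bound PP Pa (mpinv_normal J (r theta))
  (mpinv_normal (P *m J) (P *m r theta)) c01 cP.
rewrite -/x -/z in key.
have resid : norm2 (r theta - J *m x) <= norm2 (r theta).
  (* J J^+ is an orthogonal projector. *)
  have [JXJ _ JXa _] := penroseP J.
  by rewrite /x mulmxA; apply: norm2_sub_proj_le; rewrite // mulmxA JXJ.
have zx : z - x = mpinv J *m (J *m (z - x)).
  by rewrite mulmxA mpinv_left_inv// mul1mx.
have s0 : 0 <= 1 - c ^+ 2 by rewrite subr_ge0 exprn_ile1// ltW.
have S0 := sqrtr_ge0 (1 - c ^+ 2).
have trig := @sin_div_cos2_le R (Num.sqrt (1 - c ^+ 2)) c S0 c0.
rewrite (sqr_sqrtr s0) subrKC in trig; have {}trig := trig erefl.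
have X0 : 0 <= mxnorm2 (mpinv J).
  by have [] := @sigma_attained R 1 _ _ (mpinv J) n_gt0.
rewrite [in leLHS]zx; apply: (le_trans (norm2_mulmx_le _ _)).
rewrite -mulrA ler_wpM2l//.
apply: (le_trans _ (ler_wpM2l (norm2_ge0 _) trig)).
rewrite mulrA ler_pdivlMr ?exprn_gt0// mulrC.
by apply: (le_trans key); rewrite mulrC ler_wpM2r.
Qed.
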